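(* Let $f:\mathbb{R}^d\to\mathbb{R}$ be a convex differentiable function with nonempty set of minimizers $\mathcal{X}_\star$, let $f_\star=\min f$, and let $x_\star\in\mathcal{X}_\star$. Let $\mathbf{C}:\mathbb{R}^d\to\mathbb{S}^d_+$ and $L_{\mathbf{C}}\ge 0$ be such that for all $x,y\in\mathbb{R}^d$ $$f(y)+\langle\nabla f(y),x-y\rangle+\tfrac12\|x-y\|^2_{\mathbf{C}(y)}\le f(x)\le f(y)+\langle\nabla f(y),x-y\rangle+\tfrac12\|x-y\|^2_{\mathbf{C}(y)+L_{\mathbf{C}}\mathbf{I}}.$$ For $y\in\mathbb{R}^d$ let $$\mathcal{L}_{\mathbf{C}}(y)=\left\{x\in\mathbb{R}^d:\ f(y)+\langle\nabla f(y),x-y\rangle+\tfrac12\|x-y\|^2_{\mathbf{C}(y)}\le f_\star\right\}.$$ Let $x_0\in\mathbb{R}^d$ and let $(x_k)_{k\ge0}$ be the iterates of LCD2 (Local Curvature Descent 2), i.e. $x_{k+1}=\arg\min_{x\in\mathcal{L}_{\mathbf{C}}(x_k)}\tfrac12\|x-x_k\|^2$ for $k\ge0$ (the Euclidean projection of $x_k$ onto $\mathcal{L}_{\mathbf{C}}(x_k)$). Then for all $k\ge1$, $$\min_{1\le t\le k}f(x_t)-f_\star\le\frac{L_{\mathbf{C}}\|x_0-x_\star\|^2}{2k}.$$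
   Context: $\mathbb{S}^d_+$ is the set of symmetric positive semi-definite $d\times d$ real matrices, $\mathbf{I}$ is the $d\times d$ identity matrix, $\langle\cdot,\cdot\rangle$ and $\|\cdot\|$ are the standard Euclidean inner product and norm on $\mathbb{R}^d$, and $\|z\|^2_{\mathbf{A}}=\langle\mathbf{A}z,z\rangle$ for $\mathbf{A}\in\mathbb{S}^d_+$. *)

(* Defs.v *)
From HB Require Import structures.
From mathcomp Require Import all_boot all_order all_algebra.
From mathcomp Require Import all_classical all_reals all_analysis.
Import Order.TTheory GRing.Theory Num.Theory.
Import numFieldNormedType.Exports.

Set Implicit Arguments.
Unset Strict Implicit.
Unset Printing Implicit Defensive.

Local Open Scope classical_set_scope.
Local Open Scope ring_scope.

(* Vectors of R^d are column vectors. The norm `|z| that the library puts on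
   'cV[R]_d is the sup norm: it is used only through its topology (in
   differentiability); every metric quantity is expressed with [enorm]. *)
Definition dotv (R : realType) (d : nat) (u v : 'cV[R]_d) : R :=
  \sum_(i < d) u i 0 * v i 0.

Definition enorm (R : realType) (d : nat) (z : 'cV[R]_d) : R :=
  Num.sqrt (dotv z z).

Definition sqnormA (R : realType) (d : nat) (A : 'M[R]_d) (z : 'cV[R]_d) : R :=
  dotv (A *m z) z.

Definition psdmx (R : realType) (d : nat) (A : 'M[R]_d) : Prop :=
  A \is symmetricmx /\ forall z : 'cV[R]_d, 0 <= dotv (A *m z) z.

Definition grad (R : realType) (d : nat) (f : 'cV[R]_d -> R) (y : 'cV[R]_d) :
    'cV[R]_d :=
  \col_i 'D_(delta_mx i 0) f y.

Definition argmin (R : realType) (T : Type) (D : set T) (g : T -> R) : set T :=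
  [set x | D x /\ forall y, D y -> g x <= g y].

Definition is_minimum (R : realType) (T : Type) (g : T -> R) (m : R) : Prop :=
  range g m /\ lbound (range g) m.

Definition quad_model (R : realType) (d : nat) (f : 'cV[R]_d -> R)
    (A : 'M[R]_d) (y x : 'cV[R]_d) : R :=
  f y + dotv (grad f y) (x - y) + 2^-1 * sqnormA A (x - y).

Definition local_level_set (R : realType) (d : nat) (f : 'cV[R]_d -> R)
    (C : 'cV[R]_d -> 'M[R]_d) (fstar : R) (y : 'cV[R]_d) : set 'cV[R]_d :=
  [set x | quad_model f (C y) y x <= fstar].

Definition lcd2_iterates (R : realType) (d : nat) (f : 'cV[R]_d -> R)
    (C : 'cV[R]_d -> 'M[R]_d) (fstar : R) (x0 : 'cV[R]_d)
    (x : nat -> 'cV[R]_d) : Prop :=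
  x 0%N = x0 /\
  forall k : nat, argmin (local_level_set f C fstar (x k))
    (fun z => 2^-1 * enorm (z - x k) ^+ 2) (x k.+1).

(* Main.v *)
Require Import Defs.
From HB Require Import structures.
From mathcomp Require Import all_boot all_order all_algebra.
From mathcomp Require Import all_classical all_reals all_analysis.
From mathcomp Require Import ring lra.
Import Order.TTheory GRing.Theory Num.Theory.
Import numFieldNormedType.Exports.

Local Open Scope classical_set_scope.
Local Open Scope ring_scope.

Set Implicit Arguments.
Unset Strict Implicit.

(** The projection step moves [x_t] to a point [x_(t+1)] of the sublevel set of
    the lower quadratic model at [x_t].  The upper bound on [f] exceeds that
    model by exactly [LC / 2 * |x_(t+1) - x_t|^2], so
    [f x_(t+1) - fstar <= LC / 2 * |x_(t+1) - x_t|^2]: the suboptimality is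
    controlled by the squared length of the step ([level_point_gap]).

    The squared lengths are summable.  By the lower bound on [f], every such
    sublevel set contains [xstar]; it is convex, because the model is a quadratic
    with positive semi-definite Hessian ([quad_model_segment_le]).  The
    projection onto a convex set makes an obtuse angle with every point of the
    set ([projection_pythagoras]), whence
    [|x_(t+1) - x_t|^2 <= |x_t - xstar|^2 - |x_(t+1) - xstar|^2].  These bounds
    telescope to [|x0 - xstar|^2], and the minimum of [f x_1, ..., f x_k] is at
    most their average. *)

Section EuclideanForm.
Variables (R : realType) (d : nat).
Implicit Types (u v w : 'cV[R]_d) (A : 'M[R]_d) (a t : R).

Lemma dotvC u v : dotv u v = dotv v u.
Proof. by apply: eq_bigr => i _; rewrite mulrC. Qed.

Lemma dotvDl u v w : dotv (u + v) w = dotv u w + dotv v w.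
Proof. by rewrite /dotv -big_split; apply: eq_bigr => i _; rewrite mxE mulrDl. Qed.

Lemma dotvZl a u v : dotv (a *: u) v = a * dotv u v.
Proof. by rewrite /dotv mulr_sumr; apply: eq_bigr => i _; rewrite mxE mulrA. Qed.

Lemma dotvDr u v w : dotv u (v + w) = dotv u v + dotv u w.
Proof. by rewrite dotvC dotvDl !(dotvC _ u). Qed.

Lemma dotvZr a u v : dotv u (a *: v) = a * dotv u v.
Proof. by rewrite dotvC dotvZl dotvC. Qed.

Lemma dotvv_ge0 u : 0 <= dotv u u.
Proof. by apply: sumr_ge0 => i _; rewrite -expr2 sqr_ge0. Qed.

Lemma enorm_sqr u : enorm u ^+ 2 = dotv u u.
Proof. by rewrite sqr_sqrtr// dotvv_ge0. Qed.

(** The defect of affinity of a quadratic form along a segment is a multiple of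
    the form at the difference of the endpoints; its sign is what makes a
    positive semi-definite form convex. *)
Lemma sqnormA_segment A u v t :
  sqnormA A (u + t *: (v - u)) =
  (1 - t) * sqnormA A u + t * sqnormA A v - t * (1 - t) * sqnormA A (v - u).
Proof.
rewrite /sqnormA -scaleN1r !(mulmxDr, dotvDl, dotvDr, =^~ scalemxAr).
rewrite !(dotvZl, dotvZr, dotvDl, dotvDr).
ring.
Qed.

Lemma enorm_sqr_segment u v t :
  enorm (u + t *: v) ^+ 2 =
  enorm u ^+ 2 + 2 * t * dotv u v + t ^+ 2 * enorm v ^+ 2.
Proof.
by rewrite !enorm_sqr !(dotvDl, dotvDr, dotvZl, dotvZr) (dotvC v u); ring.
Qed.

(** When the set contains the segment from the projection [p] of [y] to [s],
    moving from [p] towards [s] cannot decrease the distance to [y] at first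
    order, so the angle at [p] is obtuse; the law of cosines turns this into an
    inequality between squared distances. *)
Lemma projection_pythagoras (D : set 'cV[R]_d) y p s :
  argmin D (fun z => 2^-1 * enorm (z - y) ^+ 2) p ->
  (forall t, 0 <= t <= 1 -> D (p + t *: (s - p))) ->
  enorm (p - y) ^+ 2 + enorm (p - s) ^+ 2 <= enorm (y - s) ^+ 2.
Proof.
move=> [_ p_min] segD.
set b := dotv (p - y) (s - p); set a := enorm (s - p) ^+ 2.
have a_ge0 : 0 <= a by exact: sqr_ge0.
have first_order t : 0 <= t <= 1 -> 0 <= 2 * t * b + t ^+ 2 * a.
  move=> t01; have := p_min _ (segD t t01).
  rewrite [p + _ - y]addrAC enorm_sqr_segment -/a -/b.
  lra.
have b_ge0 : 0 <= b.
  rewrite leNgt; apply/negP => b_lt0.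
  have ab_gt0 : 0 < a - b by lra.
  (* For [b < 0] this step is admissible and makes [2 * b + t * a] negative;
     the denominator [a - b] avoids treating [a = 0] apart. *)
  pose t := - b / (a - b).
  have t_gt0 : 0 < t by rewrite divr_gt0 ?oppr_gt0.
  have t_le1 : t <= 1 by rewrite ler_pdivrMr//; lra.
  have tab : t * (a - b) = - b by rewrite divfK ?gt_eqF.
  have t01 : 0 <= t <= 1 by rewrite ltW.
  have := first_order t t01.
  have -> : 2 * t * b + t ^+ 2 * a = t * (2 * b + t * a) by ring.
  rewrite pmulr_rge0// => step_ge0.
  have tb_ge : t * - b <= - b by rewrite ger_pMl// oppr_gt0.
  have tb_gt0 : 0 < t * - b by rewrite mulr_gt0 ?oppr_gt0.
  lra.
have -> : enorm (p - s) ^+ 2 = a.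
  by rewrite /a !enorm_sqr -opprB -scaleN1r dotvZl dotvZr; ring.
have -> : enorm (y - s) ^+ 2 = enorm (p - y) ^+ 2 + 2 * b + a.
  have -> : y - s = - 1 *: (p - y + 1 *: (s - p)).
    by rewrite scale1r scaleN1r [p - y + _]addrC addrA subrK opprB.
  rewrite [LHS]enorm_sqr dotvZl dotvZr -enorm_sqr enorm_sqr_segment -/a -/b.
  ring.
lra.
Qed.

End EuclideanForm.

Section QuadraticModel.
Variables (R : realType) (d : nat) (f : 'cV[R]_d -> R).
Implicit Types (p s y : 'cV[R]_d) (A : 'M[R]_d) (t : R).

Lemma quad_model_segment_le A y p s t : psdmx A -> 0 <= t <= 1 ->
  quad_model f A y (p + t *: (s - p)) <=
  (1 - t) * quad_model f A y p + t * quad_model f A y s.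
Proof.
move=> [_ A_ge0] /andP[t_ge0 t_le1]; rewrite /quad_model.
have -> : p + t *: (s - p) - y = (p - y) + t *: ((s - y) - (p - y)).
  by rewrite opprB [s - y + _]addrA subrK addrAC.
set u := p - y; set v := s - y.
rewrite sqnormA_segment.
have -> : dotv (grad f y) (u + t *: (v - u)) =
    (1 - t) * dotv (grad f y) u + t * dotv (grad f y) v.
  by rewrite -scaleN1r !(dotvDr, dotvZr); ring.
have : 0 <= t * (1 - t) * sqnormA A (v - u).
  by rewrite !mulr_ge0 ?subr_ge0//; exact: A_ge0.
lra.
Qed.

Lemma quad_model_add_scalar A a y p :
  quad_model f (A + a *: 1%:M) y p =
  quad_model f A y p + a / 2 * enorm (p - y) ^+ 2.
Proof.
rewrite /quad_model /sqnormA mulmxDl -scalemxAl mul1mx dotvDl dotvZl enorm_sqr.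
ring.
Qed.

(** The upper bound is the lower model plus an isotropic term, and the lower
    model is at most [m] on its own sublevel set. *)
Lemma level_point_gap (C : 'cV[R]_d -> 'M[R]_d) LC m y p :
  f p <= quad_model f (C y + LC *: 1%:M) y p ->
  local_level_set f C m y p ->
  f p - m <= LC / 2 * enorm (p - y) ^+ 2.
Proof. by rewrite quad_model_add_scalar /local_level_set /=; lra. Qed.

Lemma local_level_set_segment (C : 'cV[R]_d -> 'M[R]_d) m y p s t :
  psdmx (C y) -> local_level_set f C m y p -> local_level_set f C m y s ->
  0 <= t <= 1 -> local_level_set f C m y (p + t *: (s - p)).
Proof.
rewrite /local_level_set /= => C_psd p_le s_le t01.
apply: le_trans (quad_model_segment_le _ _ _ C_psd t01) _.
case/andP: t01 => t_ge0 t_le1.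
have := ler_wpM2l t_ge0 s_le.
have t'_ge0 : 0 <= 1 - t by rewrite subr_ge0.
have := ler_wpM2l t'_ge0 p_le.
lra.
Qed.

End QuadraticModel.

Lemma bigmin_le_average (R : realType) (I : eqType) (r : seq I) (a : R)
    (u : I -> R) :
  (size r)%:R * \big[Num.min/a]_(i <- r) u i <= \sum_(i <- r) u i.
Proof.
rewrite mulr_natl -sum1_size -sumrMnr.
rewrite big_seq_cond [leRHS]big_seq_cond; apply: ler_sum => i /andP[ir _].
by rewrite mulr1n ge_bigmin_seq.
Qed.

(* Since 1 <= k, using f (x 1) as the default value of the iterated minimum
   does not change its value. *)
Theorem theorem4p2 (R : realType) (d : nat) (f : 'cV[R]_d -> R)
  (f_convex : convex_function [set: 'cV[R]_d] f)
  (f_diff : forall y : 'cV[R]_d, differentiable f y)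
  (minimizers_nonempty : argmin [set: 'cV[R]_d] f !=set0)
  (fstar : R) (fstar_min : is_minimum f fstar)
  (xstar : 'cV[R]_d) (xstar_min : argmin [set: 'cV[R]_d] f xstar)
  (C : 'cV[R]_d -> 'M[R]_d) (C_psd : forall y : 'cV[R]_d, psdmx (C y))
  (LC : R) (LC_ge0 : 0 <= LC)
  (f_lower : forall x y : 'cV[R]_d, quad_model f (C y) y x <= f x)
  (f_upper : forall x y : 'cV[R]_d,
    f x <= quad_model f (C y + LC *: 1%:M) y x)
  (x0 : 'cV[R]_d) (x : nat -> 'cV[R]_d)
  (x_lcd2 : lcd2_iterates f C fstar x0 x) (k : nat) (k_ge1 : (1 <= k)%N) :
  \big[Num.min/f (x 1%N)]_(1 <= t < k.+1) f (x t) - fstar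
    <= LC * enorm (x0 - xstar) ^+ 2 / (2 * k%:R).
Proof.
have xstar_level y : local_level_set f C fstar y xstar.
  rewrite /local_level_set /=; apply: le_trans (f_lower _ _) _.
  by have [[z _ <-] _] := fstar_min; apply: (proj2 xstar_min).
have [x_0 x_step] := x_lcd2.
pose r t := enorm (x t - xstar) ^+ 2.
have gap t : f (x t.+1) - fstar <= LC / 2 * (r t - r t.+1).
  have [x_level _] := x_step t.
  apply: le_trans (level_point_gap (f_upper _ _) x_level) _.
  apply: ler_wpM2l; first by rewrite divr_ge0.
  have := projection_pythagoras (x_step t)
    (fun a => local_level_set_segment (C_psd (x t)) x_level (xstar_level _)).
  by rewrite lerBrDr.
have k_gt0 : 0 < k%:R :> R by rewrite ltr0n.
rewrite ler_pdivlMr ?mulr_gt0//.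
have sum_le : \sum_(1 <= t < k.+1) f (x t) - k%:R * fstar <= LC / 2 * r 0%N.
  have -> : \sum_(1 <= t < k.+1) f (x t) - k%:R * fstar =
      \sum_(0 <= t < k) (f (x t.+1) - fstar).
    by rewrite big_add1 sumrB sumr_const_nat subn0 mulr_natl.
  apply: le_trans (ler_sum_nat (fun t _ => gap t)) _.
  rewrite -mulr_sumr (telescope_sumr_eq (fun t => - r t))//.
    by rewrite ler_wpM2l ?divr_ge0// opprK addrC gerBl sqr_ge0.
  by move=> t _; rewrite opprK addrC.
have := bigmin_le_average (index_iota 1 k.+1) (f (x 1%N)) (f \o x).
rewrite size_iota subn1 /=.
rewrite -x_0 -/(r 0%N).
lra.
Qed.
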